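(* Let $Q=\mathbb{Z}_{q_1}\times\cdots\times\mathbb{Z}_{q_{n-1}}$. If there exists a mixed Steiner system $\mathrm{MS}(1,k,Q\times\mathbb{Z}_q)$, then $\sum_{i=1}^{n-1}(q_i-1)-(q-1)(k-1)$ is not negative and is divisible by $k$.
   Context: For integers $q_1,\dots,q_N\ge 2$, $P=\mathbb{Z}_{q_1}\times\cdots\times\mathbb{Z}_{q_N}$ is viewed as the set of words of length $N$ whose $i$-th letter lies in $\mathbb{Z}_{q_i}$. The weight of a word is its number of nonzero coordinates, and $d(\cdot,\cdot)$ is the Hamming distance. For integers $1\le t\le k\le N$, a mixed Steiner system $\mathrm{MS}(t,k,P)$ is a set $\mathcal{C}$ of words of $P$ of weight $k$ such that (i) for every word $x\in P$ of weight $t$ there is exactly one $c\in\mathcal{C}$ with $d(x,c)=k-t$; and (ii) any two distinct elements of $\mathcal{C}$ are at Hamming distance at least $2(k-t)+1$. All alphabet sizes, including $q$, are at least $2$. *)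

(* Defs.v *)
From mathcomp Require Import all_boot all_order all_algebra.

Set Implicit Arguments.
Unset Strict Implicit.
Unset Printing Implicit Defensive.

(* ['Z_p] is the ring Z/pZ only when [1 < p]; every use of [word q] must be
   accompanied by the hypothesis that all entries of [q] are at least 2. *)
Definition word (N : nat) (q : N.-tuple nat) : finType :=
  {dffun forall i : 'I_N, 'Z_(tnth q i)}.

Definition weight (N : nat) (q : N.-tuple nat) (x : word q) : nat :=
  #|[set i : 'I_N | x i != 0%R]|.

Definition hamming (N : nat) (q : N.-tuple nat) (x y : word q) : nat :=
  #|[set i : 'I_N | x i != y i]|.

(* Meaningful for [1 <= t <= k <= N], so that [k - t] is a true difference. *)
Definition mixed_steiner (N : nat) (q : N.-tuple nat) (t k : nat)
    (C : {set word q}) : Prop :=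
  [/\ forall c : word q, c \in C -> weight c = k,
      forall x : word q, weight x = t ->
        exists! c : word q, c \in C /\ hamming x c = k - t
    & forall c c' : word q, c \in C -> c' \in C -> c != c' ->
        2 * (k - t) + 1 <= hamming c c'].

(* Main.v *)
(* A codeword c is at distance k - 1 from the weight-1 word with letter a in
   position i exactly when c i = a, so the pairs (i, a) with a <> 0 are
   partitioned by the codewords, k pairs in each. Exactly q - 1 codewords are
   nonzero in the last position; counting pairs, the integer of the theorem is
   k times the number of the other codewords. *)
Require Import Defs.
From mathcomp Require Import all_boot all_order all_algebra.
From mathcomp Require Import ring.

Set Implicit Arguments.
Unset Strict Implicit.
Unset Printing Implicit Defensive.

Import Order.TTheory GRing.Theory Num.Theory.
Local Open Scope ring_scope.

(** The alphabet depends on the position, so [a] is typed only at [i]; [dfwith] supplies the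
    transport that a plain test [j == i] would lack. *)
Definition single (N : nat) (q : N.-tuple nat) (i : 'I_N)
    (a : 'Z_(tnth q i)) : word q :=
  [ffun j => dfwith (fun j : 'I_N => 0 : 'Z_(tnth q j)) a j].

Lemma single_in (N : nat) (q : N.-tuple nat) (i : 'I_N) (a : 'Z_(tnth q i)) :
  single a i = a.
Proof. by rewrite ffunE dfwith_in. Qed.

Lemma single_out (N : nat) (q : N.-tuple nat) (i j : 'I_N)
    (a : 'Z_(tnth q i)) : i != j -> single a j = 0.
Proof. by move=> neq_ij; rewrite ffunE dfwith_out. Qed.

Lemma weight_single (N : nat) (q : N.-tuple nat) (i : 'I_N)
    (a : 'Z_(tnth q i)) : a != 0 -> weight (single a) = 1%N.
Proof.
move=> a_neq0; rewrite /weight -[RHS](cards1 i); apply: eq_card => j.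
rewrite !inE; have [<-|neq_ij] := eqVneq i j; first by rewrite single_in.
by rewrite single_out ?eqxx.
Qed.

(** Away from [i] the two words differ exactly on the support of [c]. If [c i = a], the position [i]
    of that support is lost; otherwise every position of the support counts. *)
Lemma hamming_single (N : nat) (q : N.-tuple nat) (i : 'I_N)
    (a : 'Z_(tnth q i)) (c : word q) :
  a != 0 -> (0 < weight c)%N ->
  (hamming (single a) c == (weight c).-1) = (c i == a).
Proof.
move=> a_neq0 c_gt0; apply/eqP/eqP => [dist_c|ci_a].
- apply/eqP; apply: contraT => ci_neqa.
  suff : (weight c <= hamming (single a) c)%N.
    by rewrite dist_c -{1}(prednK c_gt0) ltnn.
  apply/subset_leq_card/subsetP => j; rewrite !inE.
  have [<-|neq_ij] := eqVneq i j; first by rewrite single_in (eq_sym a).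
  by rewrite single_out // (eq_sym 0).
- rewrite /weight (cardsD1 i) inE ci_a a_neq0 /=; apply: eq_card => j.
  rewrite !inE; have [<-|neq_ij] := eqVneq i j.
    by rewrite single_in ci_a eqxx.
  by rewrite single_out // (eq_sym 0).
Qed.

(** Reading off the letter at [i] is a bijection from these codewords onto the nonzero letters. *)
Lemma card_steiner_coord (N : nat) (q : N.-tuple nat) (k : nat)
    (C : {set word q}) (i : 'I_N) :
  (1 < tnth q i)%N -> (0 < k)%N -> mixed_steiner 1 k C ->
  #|[set c in C | c i != 0]| = (tnth q i).-1.
Proof.
move=> q_gt1 k_gt0 [wtC exC _].
have distC a c : a != 0 -> c \in C ->
    (hamming (single a) c == (k - 1)%N) = (c i == a).
  by move=> a_neq0 /wtC wt_c; rewrite -hamming_single ?wt_c ?subn1.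
have inj_i : {in [set c in C | c i != 0] &, injective (fun c : word q => c i)}.
  move=> c c' /setIdP[Cc ci_neq0] /setIdP[Cc' _] eq_cc'.
  (* Both [c] and [c'] are the unique codeword [d] that covers [single (c i)]. *)
  have [d [_ uniq_d]] := exC _ (weight_single ci_neq0).
  have <- : d = c by apply: uniq_d; split=> //; apply/eqP; rewrite distC.
  apply: uniq_d; split=> //; apply/eqP.
  by rewrite distC //; apply/eqP/esym.
rewrite -(card_in_imset inj_i).
(* Surjectivity: the codeword covering [single a] has letter [a] at [i]. *)
rewrite (_ : _ @: _ = [set~ 0]); last first.
  apply/setP=> a; rewrite !inE; apply/imsetP/idP => [[c /setIdP[_ ? ->]] //|a_neq0].
  have [c [[Cc dist_c] _]] := exC _ (weight_single a_neq0).
  have ci_a : c i = a by apply/eqP; rewrite -distC // dist_c.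
  by exists c; rewrite // inE Cc ci_a.
by rewrite cardsC1 card_ord Zp_cast.
Qed.

Lemma sum_card_coord (N : nat) (q : N.-tuple nat) (C : {set word q}) :
  (\sum_(i < N) #|[set c in C | c i != 0%R]| = \sum_(c in C) weight c)%N.
Proof.
transitivity (\sum_(i < N) \sum_(c in C) (c i != 0%R))%N.
  apply: eq_bigr => i _; rewrite -sum1_card -big_mkcondr.
  by apply: eq_bigl => c; rewrite inE.
rewrite exchange_big; apply: eq_bigr => c _.
by rewrite /weight -sum1_card -big_mkcond; apply: eq_bigl => i; rewrite inE.
Qed.

(* MathComp.  The length is n = m + 1: the tuple [qs] lists the alphabet sizes
   of Q, and [rcons_tuple qs q] those of Q x Z_q. *)
Theorem theorem1 (m : nat) (qs : m.-tuple nat) (q k : nat)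
    (hqs : forall i : 'I_m, (2 <= tnth qs i)%N) (hq : (2 <= q)%N)
    (hk : (1 <= k <= m.+1)%N)
    (hC : exists C : {set word (rcons_tuple qs q)}, mixed_steiner 1 k C) :
  let s : int := \sum_(i < m) ((tnth qs i)%:Z - 1)
                 - (q%:Z - 1) * (k%:Z - 1) in
  0 <= s /\ (k%:Z %| s)%Z.
Proof.
case: hC => C msC s; have /andP[k_gt0 _] := hk.
have tnth_last : tnth (rcons_tuple qs q) ord_max = q.
  by rewrite (tnth_nth 0%N) /= nth_rcons size_tuple ltnn eqxx.
have tnth_init (i : 'I_m) :
    tnth (rcons_tuple qs q) (widen_ord (leqnSn m) i) = tnth qs i.
  by rewrite !(tnth_nth 0%N) /= nth_rcons size_tuple ltn_ord.
have [wtC _ _] := msC.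
have card_last : #|[set c in C | c ord_max != 0]| = q.-1.
  by rewrite (card_steiner_coord _ k_gt0 msC) tnth_last.
have sumC : (\sum_(i < m) (tnth qs i).-1 + q.-1 = #|C| * k)%N.
  rewrite -sum_nat_const -(eq_bigr _ wtC) -sum_card_coord big_ord_recr /=.
  rewrite card_last; congr (_ + _)%N; apply: eq_bigr => i _.
  by rewrite (card_steiner_coord _ k_gt0 msC) tnth_init.
(* The cardinality of [C0] is the quotient of [s] by [k], which gives both claims at once. *)
pose C0 := [set c in C | c ord_max == 0].
have cardC : (#|C| = #|C0| + q.-1)%N.
  rewrite -card_last -(cardsID [set c : word (rcons_tuple qs q) | c ord_max == 0] C).
  by congr (_ + _)%N; apply: eq_card => c; rewrite !inE // andbC.
suff -> : s = k%:Z * #|C0|%:Z by split; [|exact: dvdz_mulr].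
have predZ n : (1 < n)%N -> n%:Z - 1 = n.-1%:Z by case: n => // n _; ring.
rewrite /s (eq_bigr (fun i => (tnth qs i).-1%:Z)); last by move=> i _; rewrite predZ.
rewrite predZ //; move/(congr1 Posz): sumC.
rewrite cardC PoszM !PoszD (big_morph Posz PoszD (erefl (0 : int))) => sumC.
(* Adding and subtracting [q - 1] makes the left side of [sumC] appear; what remains is [(#|C0| +
   (q-1)) k - (q-1) - (q-1)(k-1) = k #|C0|]. *)
rewrite -[X in X - _](addrK q.-1%:Z) sumC; ring.
Qed.
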